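(* Let $\{f_n(x,y)\}$ be a computable sequence of real functions on $\mathbb{R}^2$ and let $\{\mu_m\}$ be a computable sequence of probability distributions on $\mathbb{R}$. (1) If $\{f_n\}$ is effectively bounded, then $\{x\mapsto\int_{\mathbb{R}} f_n(x,y)\,\mu_m(dy)\}$ is an effectively bounded computable double sequence of functions (indexed by $n,m$). (2) If there exists an effectively integrable computable function $g$ on $\mathbb{R}$ such that $|f_n(x,y)|\le g(y)$ for all $n,x,y$, then $\{x\mapsto\int_{\mathbb{R}} f_n(x,y)\,dy\}$ is a computable sequence of functions on $\mathbb{R}$.
   Context: Computability is in the sense of Pour-El and Richards. A sequence of real functions $\{f_n\}$ on $\mathbb{R}$ is computable if (i) for every computable sequence of reals $\{x_j\}$ the double sequence $\{f_n(x_j)\}$ is computable, and (ii) there is a recursive $\alpha(n,L,k)$ such that $|x-y|<2^{-\alpha(n,L,k)}$ and $|x|,|y|\le L$ imply $|f_n(x)-f_n(y)|<2^{-k}$; the same definitions apply to sequences with several indices. A sequence of functions $\{f_n(x,y)\}$ on $\mathbb{R}^2$ is computable if $\{f_n(x_j,y_j)\}$ is computable for every computable sequence of pairs of reals $\{(x_j,y_j)\}$, and there is a recursive $\alpha(n,H,k)$ such that $|x|,|y|,|z|,|w|\le H$ and $|x-y|,|z-w|<2^{-\alpha(n,H,k)}$ imply $|f_n(x,z)-f_n(y,w)|<2^{-k}$. A sequence of functions is effectively bounded if there is a recursive $M(n)$ (resp. $M(n,m)$) bounding $|f_n|$ (resp. $|f_{n,m}|$) everywhere. A probability distribution is a Borel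 probability measure on $\mathbb{R}$; $\mu(f)=\int f\,d\mu$. $\{f_n\}$ on $\mathbb{R}$ is computable with compact support if computable and there is a recursive $L(n)$ with $f_n(x)=0$ for $|x|\ge L(n)$. $\{\mu_m\}$ is computable if $\{\mu_m(f_n)\}$ is a computable double sequence of reals for every computable $\{f_n\}$ with compact support. A computable function $g$ on $\mathbb{R}$ is effectively integrable if $\{\int_{[-j,j]} g^+\,dx\}$ and $\{\int_{[-j,j]} g^-\,dx\}$ (with $g^+=g\vee 0$, $g^-=(-g)\vee0$) converge effectively to finite limits as $j\to\infty$, i.e. there is a recursive $e(k)$ such that for $j\ge e(k)$ each is within $2^{-k}$ of its limit. *)

(* Defs.v *)
From HB Require Import structures.
From mathcomp Require Import all_boot all_order all_algebra.
From mathcomp Require Import all_classical all_reals all_analysis.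

Set Implicit Arguments.
Unset Strict Implicit.
Unset Printing Implicit Defensive.

Import Order.TTheory GRing.Theory Num.Theory.
Import numFieldNormedType.Exports.

Local Open Scope classical_set_scope.
Local Open Scope ring_scope.

(* Total recursive functions of k natural-number arguments: the least class
   containing zero, successor and projections, and closed under composition,
   primitive recursion (on the first argument) and minimization of regular
   functions, i.e. those for which the least zero always exists. *)
Inductive recursive : forall k : nat, (k.-tuple nat -> nat) -> Prop :=
| rec_zero : @recursive 0 (fun=> 0%N)
| rec_succ : @recursive 1 (fun t => (thead t).+1)
| rec_proj k (i : 'I_k) : @recursive k (fun t => tnth t i)
| rec_comp k m (g : m.-tuple nat -> nat) (h : 'I_m -> k.-tuple nat -> nat) :
    recursive g -> (forall i, recursive (h i)) ->
    recursive (fun t => g [tuple h i t | i < m])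
| rec_prim k (g : k.-tuple nat -> nat) (h : k.+2.-tuple nat -> nat) :
    recursive g -> recursive h ->
    @recursive k.+1 (fun t =>
      iteri (thead t)
        (fun i r => h [tuple of i :: r :: [tuple of behead t]])
        (g [tuple of behead t]))
| rec_min k (g : k.+1.-tuple nat -> nat) (f : k.-tuple nat -> nat) :
    recursive g ->
    (forall t, g [tuple of f t :: t] = 0%N) ->
    (forall t i, (i < f t)%N -> g [tuple of i :: t] <> 0%N) ->
    recursive f.

(* A k-fold sequence in T is a function k.-tuple nat -> T (k = 0: a single
   element). When a further index is added it is put in front; as recursive
   functions are closed under permutation of their arguments, the place where
   it is put is immaterial. *)
Definition seq0 T (u : T) : 0.-tuple nat -> T := fun=> u.

Definition seq1 T (u : nat -> T) : 1.-tuple nat -> T :=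
  fun t => u (tnth t ord0).

Definition seq2 T (u : nat -> nat -> T) : 2.-tuple nat -> T :=
  fun t => u (tnth t ord0) (tnth t ord_max).

Definition computable_rat k (r : k.-tuple nat -> rat) : Prop :=
  exists s a b : k.-tuple nat -> nat,
    [/\ recursive s, recursive a, recursive b &
        forall t, b t <> 0%N /\ r t = (-1) ^+ s t * ((a t)%:R / (b t)%:R)].

(* x is the limit of a computable (k+1)-fold sequence of rationals, with a
   recursive modulus of convergence e. *)
Definition computable_real (R : realType) k (x : k.-tuple nat -> R) : Prop :=
  exists (r : k.+1.-tuple nat -> rat) (e : k.+1.-tuple nat -> nat),
    [/\ computable_rat r, recursive e &
        forall (n : k.-tuple nat) (N i : nat),
          (e [tuple of N :: n] <= i)%N ->
          `|ratr (r [tuple of i :: n]) - x n| <= 2 ^- N].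

Definition computable_fun (R : realType) k (f : k.-tuple nat -> R -> R) :
    Prop :=
  (forall x : nat -> R, computable_real (seq1 x) ->
     computable_real (fun t : k.+1.-tuple nat =>
       f [tuple of behead t] (x (thead t)))) /\
  (exists alpha : k.+2.-tuple nat -> nat, recursive alpha /\
     forall (n : k.-tuple nat) (L p : nat) (x y : R),
       `|x| <= L%:R -> `|y| <= L%:R ->
       `|x - y| < 2 ^- alpha [tuple of L :: p :: n] ->
       `|f n x - f n y| < 2 ^- p).

Definition computable_fun2 (R : realType) k
    (f : k.-tuple nat -> R * R -> R) : Prop :=
  (forall x y : nat -> R,
     computable_real (seq1 x) -> computable_real (seq1 y) ->
     computable_real (fun t : k.+1.-tuple nat =>
       f [tuple of behead t] (x (thead t), y (thead t)))) /\
  (exists alpha : k.+2.-tuple nat -> nat, recursive alpha /\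
     forall (n : k.-tuple nat) (H p : nat) (x y z w : R),
       `|x| <= H%:R -> `|y| <= H%:R -> `|z| <= H%:R -> `|w| <= H%:R ->
       `|x - y| < 2 ^- alpha [tuple of H :: p :: n] ->
       `|z - w| < 2 ^- alpha [tuple of H :: p :: n] ->
       `|f n (x, z) - f n (y, w)| < 2 ^- p).

Definition effectively_bounded (R : realType) (T : Type) k
    (f : k.-tuple nat -> T -> R) : Prop :=
  exists M : k.-tuple nat -> nat, recursive M /\
    forall n x, `|f n x| <= (M n)%:R.

Definition computable_compact_support (R : realType) k
    (f : k.-tuple nat -> R -> R) : Prop :=
  computable_fun f /\
  exists L : k.-tuple nat -> nat, recursive L /\
    forall n x, (L n)%:R <= `|x| -> f n x = 0.

Definition computable_distr (R : realType)
    (mu : nat -> probability (measurableTypeR R) R) : Prop :=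
  forall f : nat -> R -> R, computable_compact_support (seq1 f) ->
    computable_real (seq2 (fun m n => \int[mu m]_x f n x)).

Definition effectively_integrable (R : realType) (g : R -> R) : Prop :=
  exists e : 1.-tuple nat -> nat, recursive e /\
  exists Ip In : R, forall k j : nat, (e [tuple k] <= j)%N ->
    `|\int[lebesgue_measure]_(x in `[- j%:R, j%:R]) g^\+ x - Ip| <= 2 ^- k /\
    `|\int[lebesgue_measure]_(x in `[- j%:R, j%:R]) g^\- x - In| <= 2 ^- k.

(* Main.v *)
(** All index tuples are coded by single natural numbers, and a sequence of reals
    is computable iff it has recursive dyadic approximations (predicate [cR]).

    (1) The integrals of the trapezoids [plateau 1 L] against [mu m] form a
    computable double sequence tending to 1 in [L], so a search yields a recursive
    [K m N] with mass at most [2 ^- N] outside a compact set. Hence the integral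
    of [f n (x j, -)], bounded by [M n], is an effective limit of integrals of
    compactly supported functions, and the modulus of continuity in [x] splits
    into the modulus of [f] on a compact set and a tail term [2 * M n * 2 ^- N].

    (2) Convergence of the integrals of [g] over [[-j, j]] bounds the tails of all
    the integrals of [f n (x, -)] at once; on [[-J, J]] they are limits of Riemann
    sums, whose mesh is given by the modulus of continuity of [f]. *)
Require Import Defs.
From HB Require Import structures.
From mathcomp Require Import all_boot all_order all_algebra.
From mathcomp Require Import all_classical all_reals all_analysis.
From mathcomp Require Import measurable_realfun.
From mathcomp Require Import ring lra zify.

Import Order.TTheory GRing.Theory Num.Theory.
Import numFieldNormedType.Exports.

Local Open Scope classical_set_scope.
Local Open Scope ring_scope.

Set Implicit Arguments.
Unset Strict Implicit.
Unset Printing Implicit Defensive.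

(** * Closure properties of recursive functions on tuples *)

Section RecursiveClosure.
Local Open Scope nat_scope.

Definition recs k m (h : k.-tuple nat -> m.-tuple nat) :=
  forall i, recursive (fun t => tnth (h t) i).

Lemma rec_ext k (f g : k.-tuple nat -> nat) : f =1 g -> recursive f -> recursive g.
Proof. by move=> /funext ->. Qed.

(** Composition for an arbitrary tuple-valued inner map, where [rec_comp] wants a family of
    functions; arguments can then be permuted, dropped or prepended freely. *)
Lemma rec_comps k m (g : m.-tuple nat -> nat) (h : k.-tuple nat -> m.-tuple nat) :
  recursive g -> recs h -> recursive (fun t => g (h t)).
Proof.
move=> rg rh.
rewrite [X in recursive X](_ : _ = fun t => g [tuple tnth (h t) i | i < m]).
  exact: rec_comp.
by apply/funext => t; congr g; apply/eq_from_tnth => i; rewrite tnth_mktuple.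
Qed.

Lemma recs_nil k (h : k.-tuple nat -> 0.-tuple nat) : recs h.
Proof. by case. Qed.

Lemma recs_cons k m f (h : k.-tuple nat -> m.-tuple nat) :
  recursive f -> recs h -> recs (fun t => [tuple of f t :: h t]).
Proof.
move=> rf rh i; case: (unliftP ord0 i) => [j|] ->.
  rewrite [X in recursive X](_ : _ = fun t => tnth (h t) j); first exact: rh.
  by apply/funext => t; rewrite tnthS.
by rewrite [X in recursive X](_ : _ = f)//; apply/funext => t; rewrite tnth0.
Qed.

Lemma recs_id k : recs (fun t : k.-tuple nat => t).
Proof. move=> i; exact: rec_proj. Qed.

Lemma recs_behead k : recs (fun t : k.+1.-tuple nat => [tuple of behead t]).
Proof.
move=> i; rewrite [X in recursive X](_ : _ = fun t => tnth t (lift ord0 i)).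
  exact: rec_proj.
by apply/funext => t; case/tupleP: t => x t; rewrite tnthS; congr tnth; apply/val_inj.
Qed.

Lemma recs_comp k m p (g : m.-tuple nat -> p.-tuple nat)
    (h : k.-tuple nat -> m.-tuple nat) :
  recs g -> recs h -> recs (fun t => g (h t)).
Proof. move=> rg rh i; exact: (rec_comps (rg i) rh). Qed.

Lemma rec_thead k : recursive (fun t : k.+1.-tuple nat => thead t).
Proof. exact: rec_proj. Qed.

Lemma rec_S k (f : k.-tuple nat -> nat) :
  recursive f -> recursive (fun t => (f t).+1).
Proof.
move=> rf.
exact: (rec_comps (h := fun t => [tuple of f t :: [tuple]]) rec_succ
          (recs_cons rf (recs_nil _))).
Qed.

Lemma rec_const k n : recursive (fun _ : k.-tuple nat => n).
Proof.
elim: n => [|n IH]; last exact: rec_S.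
exact: (rec_comps (h := fun=> [tuple]) rec_zero (recs_nil _)).
Qed.

(** Primitive recursion is run on [t] with [c t] prepended, so that the bound, the initial value and
    the step may all depend on the whole of [t]. *)
Lemma rec_iteri k (c g : k.-tuple nat -> nat)
    (h : nat -> nat -> k.-tuple nat -> nat) :
  recursive c -> recursive g ->
  recursive (fun u : k.+2.-tuple nat =>
    h (thead u) (thead [tuple of behead u])
      [tuple of behead [tuple of behead u]]) ->
  recursive (fun t => iteri (c t) (fun i r => h i r t) (g t)).
Proof.
move=> rc rg rh.
have rct : recs (fun t => [tuple of c t :: t]) by apply: recs_cons => //; exact: recs_id.
have := rec_comps (rec_prim rg rh) rct; apply: rec_ext => t /=; rewrite theadE.
congr iteri; last by congr g; apply/val_inj.
by apply/funext => i; apply/funext => r; congr h; apply/val_inj.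
Qed.

Variable k : nat.
Implicit Types f g : k.-tuple nat -> nat.

Let thead_behead (u : k.+2.-tuple nat) := thead [tuple of behead u].

Let rec_thead_behead : recursive thead_behead.
Proof. exact: (rec_comps (rec_thead _) (@recs_behead _)). Qed.

Let rec_weaken f : recursive f -> recursive (fun u : k.+2.-tuple nat =>
  f [tuple of behead [tuple of behead u]]).
Proof.
move=> rf; apply: (rec_comps rf).
exact: (recs_comp (@recs_behead _) (@recs_behead _)).
Qed.

Lemma rec_addn f g : recursive f -> recursive g ->
  recursive (fun t => f t + g t).
Proof.
move=> rf rg; rewrite [X in recursive X](_ : _ =
    fun t => iteri (f t) (fun i r => r.+1) (g t)).
  by apply: (rec_iteri (h := fun _ r _ => r.+1)) => //; apply: rec_S.
by apply/funext => t; elim: (f t) => //= n <-.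
Qed.

Lemma rec_muln f g : recursive f -> recursive g ->
  recursive (fun t => f t * g t).
Proof.
move=> rf rg; rewrite [X in recursive X](_ : _ =
    fun t => iteri (f t) (fun _ r => iteri (g t) (fun _ r => r.+1) r) 0).
  apply: (rec_iteri (h := fun _ r t => iteri (g t) (fun _ r => r.+1) r)) => //.
    exact: rec_const.
  apply: (rec_iteri (h := fun _ r _ => r.+1)) => //.
  - exact: rec_weaken.
  - apply: rec_S.
    exact: (rec_comps (rec_thead _) (@recs_behead _)).
apply/funext => t; elim: (f t) => //= n <-; rewrite mulSn.
by move: (n * g t) => p; elim: (g t) => //= m; rewrite addSn => ->.
Qed.

Lemma rec_pred f : recursive f -> recursive (fun t => (f t).-1).
Proof.
move=> rf; rewrite [X in recursive X](_ : _ =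
    fun t => iteri (f t) (fun i _ => i) 0).
  apply: (rec_iteri (h := fun i _ _ => i)) => //; first exact: rec_const.
  exact: rec_thead.
by apply/funext => t; case: (f t).
Qed.
End RecursiveClosure.

(** * Truncated subtraction, powers of 2, search and pairing *)

Section RecursiveClosure2.
Local Open Scope nat_scope.
Variable k : nat.
Implicit Types f g : k.-tuple nat -> nat.

Lemma rec_subn f g : recursive f -> recursive g ->
  recursive (fun t => f t - g t).
Proof.
move=> rf rg; rewrite [X in recursive X](_ : _ =
    fun t => iteri (g t) (fun _ r => r.-1) (f t)).
  apply: (rec_iteri (h := fun _ r _ => r.-1)) => //; apply: rec_pred.
  exact: (rec_comps (rec_thead _) (@recs_behead _)).
by apply/funext => t; elim: (g t) => [|n]/=; rewrite ?subn0// subnS => ->.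
Qed.

Lemma rec_exp2 f : recursive f -> recursive (fun t => 2 ^ f t).
Proof.
move=> rf; rewrite [X in recursive X](_ : _ =
    fun t => iteri (f t) (fun _ r => r + r) 1).
  apply: (rec_iteri (h := fun _ r _ => r + r)) => //; first exact: rec_const.
  by apply: rec_addn; exact: (rec_comps (rec_thead _) (@recs_behead _)).
apply/funext => t; elim: (f t) => //= n <-.
by rewrite expnS mul2n addnn.
Qed.

Lemma rec_search (g : nat -> k.-tuple nat -> nat) f :
  recursive (fun u : k.+1.-tuple nat => g (thead u) [tuple of behead u]) ->
  (forall t, g (f t) t = 0) -> (forall t i, i < f t -> g i t <> 0) ->
  recursive f.
Proof.
have tE i (t : k.-tuple nat) : [tuple of behead [tuple of i :: t]] = t by apply/val_inj.
move=> rg g0 gN0; apply: (rec_min rg) => [t|t i ift] /=; rewrite tE theadE.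
  exact: g0.
exact: gN0.
Qed.

(* An injective pairing with recursive projections, as
   [(a + b) ^ 2 <= (a + b) ^ 2 + a < (a + b).+1 ^ 2]. *)
Definition pr a b := (a + b) * (a + b) + a.

Lemma isqrt_subproof n : exists s, n.+1 - s.+1 * s.+1 == 0.
Proof. by exists n; rewrite subn_eq0 mulSn; apply: leq_addr. Qed.

(** The integer square root, as the least [s] with [n < s.+1 * s.+1]: the condition is a vanishing
    truncated difference, hence open to minimization. *)
Definition isqrt n := ex_minn (isqrt_subproof n).
Definition p1 n := n - isqrt n * isqrt n.
Definition p2 n := isqrt n - p1 n.

Lemma isqrt_pr a b : isqrt (pr a b) = a + b.
Proof.
rewrite /isqrt; case: ex_minnP => m /eqP; rewrite /pr => H1 H2.
have H3 : m <= a + b by apply: H2; nia.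
nia.
Qed.

Lemma p1_pr a b : p1 (pr a b) = a.
Proof. by rewrite /p1 isqrt_pr /pr addKn. Qed.

Lemma p2_pr a b : p2 (pr a b) = b.
Proof. by rewrite /p2 isqrt_pr p1_pr addKn. Qed.

Lemma rec_pr f g : recursive f -> recursive g -> recursive (fun t => pr (f t) (g t)).
Proof.
move=> rf rg; apply: (rec_addn (f := fun t => _) _ rf).
by apply: (rec_muln (f := fun t => _)); apply: (rec_addn rf rg).
Qed.
End RecursiveClosure2.

(* Recursion theory with a single variable, several ones being coded by [pr]. *)
Section Crec.
Local Open Scope nat_scope.
Implicit Types f g h : nat -> nat.

Definition crec f := recursive (seq1 f).
Definition crec2 (F : nat -> nat -> nat) := crec (fun z => F (p1 z) (p2 z)).
Definition crec3 (F : nat -> nat -> nat -> nat) :=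
  crec2 (fun a z => F a (p1 z) (p2 z)).

Lemma crec_rec k f (g : k.-tuple nat -> nat) : crec f -> recursive g ->
  recursive (fun t => f (g t)).
Proof.
move=> rf rg; apply: (rec_comps (h := fun t => [tuple of g t :: [tuple]]) rf).
by apply: recs_cons => //; exact: recs_nil.
Qed.

Lemma crec_comp f g : crec f -> crec g -> crec (fun n => f (g n)).
Proof. exact: crec_rec. Qed.

Lemma crec2_rec k F (f g : k.-tuple nat -> nat) : crec2 F -> recursive f -> recursive g ->
  recursive (fun t => F (f t) (g t)).
Proof.
move=> rF rf rg; rewrite [X in recursive X](_ : _ =
  fun t => F (p1 (pr (f t) (g t))) (p2 (pr (f t) (g t)))).
  exact: (crec_rec rF (rec_pr rf rg)).
by apply/funext => t; rewrite p1_pr p2_pr.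
Qed.

Lemma crec3_rec k F (f g h : k.-tuple nat -> nat) : crec3 F ->
  recursive f -> recursive g -> recursive h ->
  recursive (fun t => F (f t) (g t) (h t)).
Proof.
move=> rF rf rg rh; rewrite [X in recursive X](_ : _ =
  fun t => F (f t) (p1 (pr (g t) (h t))) (p2 (pr (g t) (h t)))).
  exact: (crec2_rec rF rf (rec_pr rg rh)).
by apply/funext => t; rewrite p1_pr p2_pr.
Qed.

Lemma crec2_comp F f g : crec2 F -> crec f -> crec g -> crec (fun n => F (f n) (g n)).
Proof. exact: crec2_rec. Qed.

Lemma crec3_comp F f g h : crec3 F -> crec f -> crec g -> crec h ->
  crec (fun n => F (f n) (g n) (h n)).
Proof. exact: crec3_rec. Qed.

Lemma crec_id : crec id.
Proof. exact: rec_proj. Qed.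

Lemma crec_const n : crec (fun=> n).
Proof. exact: rec_const. Qed.

Lemma crec_S f : crec f -> crec (fun n => (f n).+1).
Proof. exact: rec_S. Qed.

Lemma crec_addn f g : crec f -> crec g -> crec (fun n => f n + g n).
Proof. exact: rec_addn. Qed.

Lemma crec_muln f g : crec f -> crec g -> crec (fun n => f n * g n).
Proof. exact: rec_muln. Qed.

Lemma crec_subn f g : crec f -> crec g -> crec (fun n => f n - g n).
Proof. exact: rec_subn. Qed.

Lemma crec_exp2 f : crec f -> crec (fun n => 2 ^ f n).
Proof. exact: rec_exp2. Qed.

Lemma crec_pr f g : crec f -> crec g -> crec (fun n => pr (f n) (g n)).
Proof. exact: rec_pr. Qed.

Lemma crec_maxn f g : crec f -> crec g -> crec (fun n => maxn (f n) (g n)).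
Proof.
move=> rf rg; rewrite [X in crec X](_ : _ = fun n => f n + (g n - f n)).
  by apply: crec_addn => //; apply: crec_subn.
by apply/funext => n; rewrite maxnE.
Qed.

Lemma crec_isqrt : crec isqrt.
Proof.
apply: (rec_search (g := fun i t => (tnth t ord0).+1 - i.+1 * i.+1)).
- apply: rec_subn; first by apply: rec_S; exact: (recs_behead ord0).
  by apply: rec_muln; apply: rec_S; apply: rec_thead.
- by move=> t; rewrite /seq1 /isqrt; case: ex_minnP => m /eqP.
- move=> t i; rewrite /seq1 /isqrt; case: ex_minnP => m _ mP im /eqP /mP.
  by rewrite leqNgt im.
Qed.

Lemma crec_p1 f : crec f -> crec (fun n => p1 (f n)).
Proof.
move=> rf; have rs := crec_comp crec_isqrt rf.
by apply: crec_subn => //; apply: crec_muln.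
Qed.

Lemma crec_p2 f : crec f -> crec (fun n => p2 (f n)).
Proof.
move=> rf; have rs := crec_comp crec_isqrt rf.
by apply: crec_subn => //; apply: crec_p1.
Qed.

Lemma crec_iteri f g (h : nat -> nat -> nat -> nat) :
  crec f -> crec g -> crec3 h ->
  crec (fun n => iteri (f n) (fun i r => h n i r) (g n)).
Proof.
move=> rf rg rh; apply: (rec_iteri (h := fun i r t => h (tnth t ord0) i r)) => //.
apply: crec3_rec => //; first 2 last.
- exact: (rec_comps (rec_thead _) (@recs_behead _)).
- exact: (rec_comps (rec_thead _) (recs_comp (@recs_behead _) (@recs_behead _))).
- exact: rec_thead.
Qed.

Lemma crec_search (g : nat -> nat -> nat) f : crec2 g ->
  (forall n, g n (f n) = 0) -> (forall n i, i < f n -> g n i <> 0) -> crec f.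
Proof.
move=> rg g0 gN0; apply: (rec_search (g := fun i t => g (tnth t ord0) i)).
- apply: crec2_rec => //; last exact: rec_thead.
  exact: (recs_behead ord0).
- by move=> t; apply: g0.
- by move=> t; apply: gN0.
Qed.

Lemma crec_sum f (F : nat -> nat -> nat) : crec f -> crec2 F ->
  crec (fun n => \sum_(i < f n) F n i).
Proof.
move=> rf rF; rewrite [X in crec X](_ : _ =
    fun n => iteri (f n) (fun i r => r + F n i) 0).
  apply: (crec_iteri (h := fun n i r => r + F n i)) => //; first exact: crec_const.
  apply: crec_addn; first by apply/crec_p2/crec_p2/crec_id.
  apply: crec2_comp => //; first by apply/crec_p1/crec_id.
  by apply/crec_p1/crec_p2/crec_id.
apply/funext => n; elim: (f n) => [|m IH]/=; first by rewrite big_ord0.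
by rewrite big_ord_recr IH.
Qed.

(** The quotient is the least [q] with [f n < q.+1 * g n], found by search. *)
Lemma crec_divn f g : crec f -> crec g -> (forall n, 0 < g n) ->
  crec (fun n => f n %/ g n).
Proof.
move=> rf rg g0.
apply: (crec_search (g := fun n q => (f n).+1 - q.+1 * g n)).
- apply: crec_subn; first by apply/crec_S/crec_comp => //; apply/crec_p1/crec_id.
  apply: crec_muln; first by apply/crec_S/crec_p2/crec_id.
  by apply/crec_comp => //; apply/crec_p1/crec_id.
- by move=> n; apply/eqP; rewrite subn_eq0 ltn_ceil.
- move=> n i; rewrite leq_divRL// => ifg /eqP.
  by rewrite subn_eq0 ltnNge ifg.
Qed.
End Crec.
(** The goal is taken apart along its outermost operation, other functions being looked up in the
    context; several arguments are reduced to one through [p1] and [p2]. *)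
Ltac crec := cbv beta; match goal with
  | H : crec ?f |- crec ?f => exact H
  | H : crec2 ?f |- crec2 ?f => exact H
  | H : crec3 ?f |- crec3 ?f => exact H
  | |- crec3 ?f => change (crec (fun z => f (p1 z) (p1 (p2 z)) (p2 (p2 z)))); crec
  | |- crec2 ?f => change (crec (fun z => f (p1 z) (p2 z))); crec
  | |- crec (fun n => n) => exact crec_id
  | |- crec (fun=> ?c) => exact (crec_const c)
  | |- crec S => exact (crec_S crec_id)
  | |- crec p1 => exact (crec_p1 crec_id)
  | |- crec p2 => exact (crec_p2 crec_id)
  | |- crec (fun n => p1 (@?f n)) => apply (@crec_p1 f); crec
  | |- crec (fun n => p2 (@?f n)) => apply (@crec_p2 f); crec
  | |- crec (fun n => S (@?f n)) => apply (@crec_S f); crec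
  | |- crec (fun n => addn (@?f n) (@?g n)) => apply (@crec_addn f g); crec
  | |- crec (fun n => muln (@?f n) (@?g n)) => apply (@crec_muln f g); crec
  | |- crec (fun n => subn (@?f n) (@?g n)) => apply (@crec_subn f g); crec
  | |- crec (fun n => maxn (@?f n) (@?g n)) => apply (@crec_maxn f g); crec
  | |- crec (fun n => expn 2 (@?f n)) => apply (@crec_exp2 f); crec
  | |- crec (fun n => pr (@?f n) (@?g n)) => apply (@crec_pr f g); crec
  | H : crec ?F |- crec (fun n => ?F (@?a n)) => apply (@crec_comp F a H); crec
  | H : crec2 ?F |- crec (fun n => ?F (@?a n) (@?b n)) =>
      apply (@crec2_comp F a b H); crec
  | H : crec3 ?F |- crec (fun n => ?F (@?a n) (@?b n) (@?c n)) =>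
      apply (@crec3_comp F a b c H); crec
  | _ => idtac
  end.


(** * Computable sequences of reals through dyadic approximations *)

Section ComputableSequences.
Variable R : realType.
Implicit Types x y : nat -> R.

(* Integer multiples of [2 ^- N.+1] as approximations leave room for the
   rounding in [cR_rat]; integers are differences of natural numbers. *)
Definition cR x := exists p q : nat -> nat -> nat, [/\ crec2 p, crec2 q &
  forall n N, `|((p n N)%:R - (q n N)%:R) / 2 ^+ N.+1 - x n| <= 2 ^- N].

Definition cR2 (x : nat -> nat -> R) := cR (fun z => x (p1 z) (p2 z)).

(** Splits error budgets: once rewritten with it, they are linear in powers of 2 that [lra] treats
    as atoms. *)
Lemma half_expV n : 2 ^- n = 2 ^- n.+1 + 2 ^- n.+1 :> R.
Proof.
by rewrite exprS invfM mulrC; have := splitr (2 ^- n : R).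
Qed.

Lemma expV2_ge0 n : 0 <= 2 ^- n :> R.
Proof. by rewrite invr_ge0 exprn_ge0. Qed.

Lemma expV2_gt0 n : 0 < 2 ^- n :> R.
Proof. by rewrite invr_gt0 exprn_gt0. Qed.

Lemma ler_expV2 m n : (m <= n)%N -> 2 ^- n <= 2 ^- m :> R.
Proof. by move=> mn; rewrite lef_pV2 ?posrE ?exprn_gt0// ler_weXn2l// ler1n. Qed.

(** Rounding down errs on one side only, so in a difference of two rounded fractions the errors
    offset each other and stay within [1 / c] instead of [2 / c]. *)
Lemma floor_error (a d c : nat) : (0 < d)%N -> (0 < c)%N ->
  0 <= a%:R / d%:R - ((a * c) %/ d)%:R / c%:R :> R /\
  a%:R / d%:R - ((a * c) %/ d)%:R / c%:R <= c%:R^-1 :> R.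
Proof.
move=> d0 c0; have dR : 0 < d%:R :> R by rewrite ltr0n.
have cR0 : 0 < c%:R :> R by rewrite ltr0n.
have e : a%:R / d%:R = ((a * c)%:R / d%:R) / c%:R :> R.
  by rewrite natrM; field; rewrite !gt_eqF.
rewrite e -mulrBl; set u := (_ - _).
have u0 : 0 <= u by rewrite subr_ge0 ler_pdivlMr// -natrM ler_nat leq_trunc_div.
have u1 : u <= 1.
  rewrite lerBlDr ler_pdivrMr// -[1]/(1%:R) -natrD -natrM ler_nat add1n.
  by rewrite ltnW// ltn_ceil.
split; first by rewrite divr_ge0// ltW.
by rewrite ler_pdivrMr// mulVf// gt_eqF.
Qed.

(** Admits arbitrary recursive denominators: half of the error [2 ^- N] is left to the given
    fractions, the other half to rounding to denominator [2 ^ N.+1]. *)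
Lemma cR_rat x (p q d : nat -> nat -> nat) :
  crec2 p -> crec2 q -> crec2 d -> (forall n N, (0 < d n N)%N) ->
  (forall n N, `|((p n N)%:R - (q n N)%:R) / (d n N)%:R - x n| <= 2 ^- N.+1) ->
  cR x.
Proof.
move=> rp rq rd d0 pqx.
have r2 : crec (fun z => 2 ^ (p2 z).+1)%N by crec.
have rdiv (a : nat -> nat -> nat) : crec2 a ->
    crec2 (fun n N => (a n N * 2 ^ N.+1) %/ d n N)%N.
  by move=> ra; apply: crec_divn => //; crec.
exists (fun n N => (p n N * 2 ^ N.+1) %/ d n N)%N.
exists (fun n N => (q n N * 2 ^ N.+1) %/ d n N)%N.
split; [exact: rdiv|exact: rdiv|move=> n N].
have := pqx n N.
have [||P0 P1] := @floor_error (p n N) (d n N) (2 ^ N.+1)%N; rewrite ?expn_gt0//.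
have [||Q0 Q1] := @floor_error (q n N) (d n N) (2 ^ N.+1)%N; rewrite ?expn_gt0//.
move: P0 P1 Q0 Q1; rewrite natrX (half_expV N) !mulrBl !ler_norml; lra.
Qed.

Lemma cR_comp x f : cR x -> crec f -> cR (fun n => x (f n)).
Proof.
move=> [p [q [rp rq pqx]]] rf; exists (fun n => p (f n)), (fun n => q (f n)).
have rfp : crec (fun z => f (p1 z)) by crec.
by split => [||n N]; rewrite ?pqx//; crec.
Qed.

Lemma cR2_comp (x : nat -> nat -> R) f g : cR2 x -> crec f -> crec g ->
  cR (fun n => x (f n) (g n)).
Proof.
move=> cx rf rg; have := cR_comp cx (crec_pr rf rg).
by congr cR; apply/funext => n; rewrite p1_pr p2_pr.
Qed.

Lemma cR_N x : cR x -> cR (fun n => - x n).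
Proof.
move=> [p [q [rp rq pqx]]]; exists q, p; split => // n N.
by rewrite -(opprB (p n N)%:R) mulNr -opprD normrN.
Qed.

Lemma ler_dist_max (a b c d e : R) : `|a - c| <= e -> `|b - d| <= e ->
  `|Num.max a b - Num.max c d| <= e.
Proof. by rewrite !ler_norml !maxEle; case: ifP; case: ifP; lra. Qed.

(** Since [max] is 1-Lipschitz for the maximum norm, no extra precision is needed; and [max (p - q)
    (p' - q') = max (p + q') (p' + q) - (q + q')] is again a difference of naturals. *)
Lemma cR_max x y : cR x -> cR y -> cR (fun n => Num.max (x n) (y n)).
Proof.
move=> [p [q [rp rq pqx]]] [p' [q' [rp' rq' pqy]]].
exists (fun n N => maxn (p n N + q' n N) (p' n N + q n N))%N.
exists (fun n N => q n N + q' n N)%N.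
split; [crec|crec|move=> n N].
have := ler_dist_max (pqx n N) (pqy n N); congr (`|_ - _| <= _).
rewrite -maxr_pMl ?expV2_ge0//; congr (_ / _).
rewrite /maxn maxEle; case: ltnP => H; move: H;
  rewrite -(ltr_nat R, ler_nat R) !natrD => H; case: lerP; lra.
Qed.

Lemma cR_min x y : cR x -> cR y -> cR (fun n => Num.min (x n) (y n)).
Proof.
move=> cx cy; have := cR_N (cR_max (cR_N cx) (cR_N cy)).
by congr cR; apply/funext => n; rewrite oppr_max !opprK.
Qed.

Lemma cR_norm x : cR x -> cR (fun n => `|x n|).
Proof.
move=> cx; have := cR_max cx (cR_N cx).
by congr cR; apply/funext => n; rewrite maxEle; case: (ger0P (x n)); case: ifP; lra.
Qed.

Lemma cR_addn x f : cR x -> crec f -> cR (fun n => (f n)%:R + x n).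
Proof.
move=> [p [q [rp rq pqx]]] rf.
exists (fun n N => f n * 2 ^ N.+1 + p n N)%N, q.
have rfp : crec (fun z => f (p1 z)) by crec.
split => // [|n N].
  by crec.
have := pqx n N; congr (`|_| <= _).
by rewrite natrD natrM natrX; field; rewrite expf_neq0// pnatr_eq0.
Qed.

Lemma cR_rat0 f g s : crec f -> crec g -> crec s ->
  cR (fun n => ((f n)%:R - (g n)%:R) / 2 ^+ s n).
Proof.
move=> rf rg rs.
have r1 h : crec h -> crec2 (fun n N => h n).
  by move=> rh; crec.
apply: (cR_rat (p := fun n N => f n) (q := fun n N => g n)
               (d := fun n N => 2 ^ s n)%N); try exact: r1.
- by crec.
- by move=> n N; rewrite expn_gt0.
- by move=> n N; rewrite natrX subrr normr0 expV2_ge0.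
Qed.

Lemma cR_nat f : crec f -> cR (fun n => (f n)%:R).
Proof.
move=> rf; have := cR_rat0 rf (crec_const 0) (crec_const 0).
by congr cR; apply/funext => n; rewrite subr0 expr0 divr1.
Qed.

(** Diagonal argument: approximating [y n N.+2] to within [2 ^- N.+2] gives a total error
    [2 ^- N.+1], which is what [cR_rat] accepts. *)
Lemma cR_lim x (y : nat -> nat -> R) : cR2 y ->
  (forall n N, `|y n N - x n| <= 2 ^- N) -> cR x.
Proof.
move=> [p [q [rp rq pqy]]] yx.
have r1 : crec (fun z => pr (p1 z) (p2 z).+2).
  by crec.
have r2 : crec (fun z => (p2 z).+2) by crec.
apply: (cR_rat (p := fun n N => p (pr n N.+2) N.+2)
  (q := fun n N => q (pr n N.+2) N.+2) (d := fun n N => 2 ^ N.+3)%N).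
- by crec.
- by crec.
- by crec.
- by move=> n N; rewrite expn_gt0.
- move=> n N; have := pqy (pr n N.+2) N.+2; rewrite p1_pr p2_pr.
  have := yx n N.+2; rewrite natrX (half_expV N.+1).
  rewrite !ler_norml; lra.
Qed.

Lemma cR_sum (y : nat -> nat -> R) f s : cR2 y -> crec f -> crec s ->
  cR (fun n => (\sum_(i < f n) y n i) / 2 ^+ s n).
Proof.
move=> [p [q [rp rq pqy]]] rf rs.
have rfp : crec (fun z => f (p1 z)) by crec.
have rsp : crec (fun z => s (p1 z)) by crec.
(* As [f n <= 2 ^ f n], the [f n] extra bits make the [f n] errors add up to at most [2 ^- N.+1];
   dividing by [2 ^+ s n] does not increase this. *)
pose prec n N := (N.+1 + f n)%N.
have rprec : crec2 prec by rewrite /prec; crec.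
have rsum (a : nat -> nat -> nat) : crec2 a ->
    crec2 (fun n N => \sum_(i < f n) a (pr n i) (prec n N))%N.
  move=> ra; apply: (crec_sum (F := fun z i => a (pr (p1 z) i) (prec (p1 z) (p2 z)))) => //.
  by crec.
apply: (@cR_rat _ (fun n N => \sum_(i < f n) p (pr n i) (prec n N))%N
  (fun n N => \sum_(i < f n) q (pr n i) (prec n N))%N
  (fun n N => 2 ^ ((prec n N).+1 + s n))%N).
- exact: rsum.
- exact: rsum.
- by crec.
- by move=> n N; rewrite expn_gt0.
move=> n N; rewrite natrX exprD invfM mulrA -mulrBl normrM.
rewrite (ger0_norm (expV2_ge0 _)) !natr_sum -sumrB mulr_suml -sumrB.
have lef : (f n)%:R <= 2 ^+ f n :> R by rewrite -natrX ler_nat ltnW// ltn_expl.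
have le1 : `|\sum_(i < f n) (((p (pr n i) (prec n N))%:R -
    (q (pr n i) (prec n N))%:R) / 2 ^+ (prec n N).+1 - y n i)| <= 2 ^- N.+1.
  apply: (le_trans (ler_norm_sum _ _ _)).
  apply: (@le_trans _ _ (\sum_(i < f n) 2 ^- (prec n N))).
    by apply: ler_sum => i _; have := pqy (pr n i) (prec n N); rewrite p1_pr p2_pr.
  rewrite sumr_const card_ord -[_ *+ f n]mulr_natl /prec exprD invfM mulrCA.
  by rewrite ler_piMr ?expV2_ge0// ler_pdivrMr ?exprn_gt0// mul1r.
apply: le_trans le1; rewrite ler_piMr//.
by rewrite invf_le1 ?exprn_gt0// exprn_ege1// ler1n.
Qed.

Lemma cR_bound x : cR x -> exists B, crec B /\ forall n, `|x n| <= (B n)%:R.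
Proof.
move=> [p [q [rp rq pqx]]]; exists (fun n => p n 0 + q n 0 + 1)%N; split.
  by crec.
move=> n; have := pqx n 0; rewrite expr0 invr1 expr1 !natrD !ler_norml.
have := ler0n R (p n 0); have := ler0n R (q n 0); lra.
Qed.

(** An inequality between reals cannot be decided, so the search tests the approximation of error
    [2 ^- N.+2] against [1 - 2 ^- N.+1]. The test succeeds once [phi m L > 1 - 2 ^- N.+2], and its
    success ensures [phi m L >= 1 - 2 ^- N]. *)
Lemma cR_search (phi : nat -> nat -> R) : cR2 phi ->
  (forall m e, 0 < e -> exists L, 1 - e < phi m L) ->
  exists T, crec2 T /\ forall m N, 1 - 2 ^- N <= phi m (T m N).
Proof.
move=> [p [q [rp rq pqphi]]] ex.
(* The test multiplied by [2 ^ N.+3], the denominator of the approximation; 4 is [2 ^- N.+1] times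
   this factor. *)
pose g m N L := (2 ^ N.+3 + q (pr m L) N.+2 - (p (pr m L) N.+2 + 4))%N.
have gE m N L : (g m N L == 0%N) = (1 - 2 ^- N.+1 <=
    ((p (pr m L) N.+2)%:R - (q (pr m L) N.+2)%:R) / 2 ^+ N.+3 :> R).
  rewrite /g subn_eq0 -(ler_nat R) natrD natrX natrD.
  rewrite ler_pdivlMr ?exprn_gt0// mulrBl mul1r.
  have -> : 2 ^- N.+1 * 2 ^+ N.+3 = 4 :> R.
    by rewrite -(addn2 N.+1) exprD mulKf ?expf_neq0// expr2 -natrM.
  by apply/idP/idP; lra.
have gP m N : exists L, g m N L == 0%N.
  have [L phiL] := ex m _ (expV2_gt0 N.+2); exists L; rewrite gE.
  have := pqphi (pr m L) N.+2; rewrite p1_pr p2_pr.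
  rewrite ler_norml => /andP[+ _]; rewrite (half_expV N.+1); lra.
exists (fun m N => ex_minn (gP m N)); split.
  apply: (crec_search (g := fun z L => g (p1 z) (p2 z) L)) => [|z|z i].
  - by rewrite /g; crec.
  - by case: ex_minnP => L /eqP.
  - by case: ex_minnP => L _ LP iL /eqP /LP; rewrite leqNgt iL.
move=> m N; case: ex_minnP => L + _.
have := pqphi (pr m L) N.+2; rewrite p1_pr p2_pr gE.
rewrite ler_norml => /andP[_ +]; rewrite (half_expV N) (half_expV N.+1).
by have := expV2_ge0 N.+2; lra.
Qed.

(** * Passage between coded indices and index tuples *)

Definition trec k (a : nat -> k.-tuple nat) := forall i, crec (fun n => tnth (a n) i).

Lemma trec_nil (a : nat -> 0.-tuple nat) : trec a.
Proof. by case. Qed.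

Lemma trec_cons k f (a : nat -> k.-tuple nat) : crec f -> trec a ->
  trec (fun n => [tuple of f n :: a n]).
Proof.
move=> rf ra; exact: (recs_cons (h := fun t => a (tnth t ord0)) rf ra).
Qed.

Lemma trec_comp k (F : k.-tuple nat -> nat) a : recursive F -> trec a ->
  crec (fun n => F (a n)).
Proof.
move=> rF ra; exact: (rec_comps (h := fun t => a (tnth t ord0)) rF ra).
Qed.

Lemma trec_reindex k (a : nat -> k.-tuple nat) f : trec a -> crec f ->
  trec (fun n => a (f n)).
Proof. by move=> ra rf i; apply: (crec_comp (ra i)). Qed.

(** Iterating [1 - r] from 0 computes the parity, which decides the sign [(-1) ^+ s] of a
    rational. *)
Lemma crec_odd f : crec f -> crec (fun n => odd (f n)).
Proof.
move=> rf; rewrite [X in crec X](_ : _ = fun n => iteri (f n) (fun _ r => 1 - r)%N 0%N).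
  apply: (crec_iteri (h := fun _ _ r => 1 - r)%N) => //; first exact: crec_const.
  by rewrite /crec3; crec.
by apply/funext => n; elim: (f n) => //= m <-; case: odd.
Qed.

(** The rational is taken where the modulus grants error [2 ^- N.+1], as [cR_rat] requires. Its
    numerator goes to the positive part when the sign exponent is even, and to the negative part
    when it is odd. *)
Lemma cR_of_computable k (X : k.-tuple nat -> R) a :
  computable_real X -> trec a -> cR (fun n => X (a n)).
Proof.
move=> [r [e [[s [u [v [rs ru rv rE]]]] re Xe]]] ra.
have ra1 : trec (fun z => a (p1 z)) by apply: trec_reindex => //; crec.
pose i n N := e [tuple of N.+1 :: a n].
have ri : crec2 i by apply: trec_comp => //; apply: trec_cons => //; crec.
pose t n N := [tuple of i n N :: a n].
have rt (F : k.+1.-tuple nat -> nat) : recursive F -> crec2 (fun n N => F (t n N)).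
  by move=> rF; apply: trec_comp => //; apply: trec_cons.
have rodd := crec_odd (rt _ rs); have rut := rt _ ru; have rvt := rt _ rv.
apply: (@cR_rat _ (fun n N => u (t n N) * (1 - odd (s (t n N))))%N
  (fun n N => u (t n N) * odd (s (t n N)))%N (fun n N => v (t n N))) => //.
- by apply: crec_muln => //; apply: crec_subn => //; exact: crec_const.
- by apply: crec_muln.
- by move=> n N; have [/eqP] := rE (t n N); rewrite lt0n.
move=> n N; have := Xe (a n) N.+1 _ (leqnn _); congr (`|_ - _| <= _).
have [_ ->] := rE (t n N); rewrite -signr_odd.
rewrite rmorphM rmorph_sign fmorph_div/= !ratr_nat.
by case: odd; rewrite !(subnn, subn0, muln1, muln0, expr0, expr1, mul1r, subr0, sub0r, mulNr).
Qed.

(** The rational of index [i] is the approximation of error [2 ^- i], so the modulus of convergence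
    is the identity. *)
Lemma computable_of_cR k x (c : k.-tuple nat -> nat) :
  cR x -> recursive c -> computable_real (fun t => x (c t)).
Proof.
move=> [p [q [rp rq pqx]]] rc.
pose P (u : k.+1.-tuple nat) := p (c [tuple of behead u]) (thead u).
pose Q (u : k.+1.-tuple nat) := q (c [tuple of behead u]) (thead u).
have rcb : recursive (fun u : k.+1.-tuple nat => c [tuple of behead u]).
  exact: (rec_comps rc (@recs_behead _)).
have rP : recursive P by apply: crec2_rec => //; exact: rec_thead.
have rQ : recursive Q by apply: crec2_rec => //; exact: rec_thead.
(* By truncated subtraction, [s] is 1 exactly when [P u < Q u], and [P u - Q u + (Q u - P u)] is the
   absolute difference. *)
pose s u := (1 - (1 - (Q u - P u)))%N.
pose b (u : k.+1.-tuple nat) := (2 ^ (thead u).+1)%N.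
exists (fun u => (-1) ^+ s u * ((P u - Q u + (Q u - P u))%N%:R / (b u)%:R)), (fun u => thead u).
have rPQ : recursive (fun u => P u - Q u)%N by exact: rec_subn.
have rQP : recursive (fun u => Q u - P u)%N by exact: rec_subn.
split; last 1 first.
- move=> n N i; rewrite theadE => Ni.
  have := pqx (c n) i; rewrite /s /b /P /Q !theadE.
  have -> : [tuple of behead [tuple of i :: n]] = n by apply/val_inj.
  move=> H; apply: le_trans (ler_expV2 Ni); move: H; congr (`|_ - _| <= _).
  rewrite rmorphM rmorphXn rmorphN1 fmorph_div/= !ratr_nat natrX mulrA; congr (_ / _).
  case: (leqP (q (c n) i) (p (c n) i)) => H.
    have /eqP -> : (q (c n) i - p (c n) i == 0)%N by rewrite subn_eq0.
    by rewrite subn0 subnn expr0 mul1r addn0 natrB.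
  have /eqP -> : (p (c n) i - q (c n) i == 0)%N by rewrite subn_eq0 ltnW.
  have -> : (1 - (1 - (q (c n) i - p (c n) i)) = 1)%N by lia.
  by rewrite expr1 mulN1r add0n natrB ?opprB// ltnW.
- exists s, (fun u => P u - Q u + (Q u - P u))%N, b; split => //.
  + by apply: rec_subn; [exact: rec_const|apply: rec_subn => //; exact: rec_const].
  + exact: rec_addn.
  + by apply: rec_exp2; apply: rec_S; exact: rec_thead.
  + by move=> t; split => //; apply/eqP; rewrite -lt0n expn_gt0.
- exact: rec_thead.
Qed.

Lemma cR_seq1 x : cR x <-> computable_real (seq1 x).
Proof.
split=> [cx|cx].
  exact: (computable_of_cR cx (rec_proj ord0)).
have := cR_of_computable cx (trec_cons crec_id (@trec_nil (fun=> [tuple]))).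
by congr cR; apply/funext => n; rewrite /seq1 tnth0.
Qed.

End ComputableSequences.

(** * Comparison of real-valued integrals *)

Section RealIntegrals.
Context d (T : measurableType d) (R : realType) (mu : {measure set T -> \bar R}).

Lemma ler_dist_Rintegral (D : set T) (f g h : T -> R) : measurable D ->
  mu.-integrable D (EFin \o f) -> mu.-integrable D (EFin \o g) ->
  mu.-integrable D (EFin \o h) -> (forall x, D x -> `|f x - g x| <= h x) ->
  `|\int[mu]_(x in D) f x - \int[mu]_(x in D) g x| <= \int[mu]_(x in D) h x.
Proof.
move=> mD intf intg inth fgh; rewrite -RintegralB//.
have intfg : mu.-integrable D (EFin \o (fun x => f x - g x)).
  by have := integrableB mD intf intg; apply: eq_integrable => // x _.
apply: (le_trans (le_normr_Rintegral mD intfg)).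
apply: le_Rintegral => //.
by have := integrable_abse intfg; apply: eq_integrable.
Qed.
End RealIntegrals.

(** * Continuity from moduli, trapezoids and clamping *)

Section ContinuousFunctions.
Variable R : realType.
Implicit Types (f g : R -> R).

Lemma continuous_of_modulus f :
  (forall L p, exists a, forall x y, `|x| <= L%:R -> `|y| <= L%:R ->
     `|x - y| < 2 ^- a -> `|f x - f y| < 2 ^- p) ->
  continuous f.
Proof.
move=> mf x; apply/cvgrPdist_lt => e e0.
have [p _ /(_ p (leqnn _))] := near_infty_natSinv_expn_lt (PosNum e0).
rewrite /= mul1r => pe.
(* The margin 1 keeps all points within distance 1 of [x] in the range of the modulus. *)
have [L xL] : exists L : nat, `|x| + 1 <= L%:R.
  by exists (Num.truncn (`|x| + 1)).+1; apply: ltW; exact: truncnS_gt.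
have [a fa] := mf L p.
have n1 : \forall y \near x, `|x - y| < 1 by exact: nbhsx_ballx.
have n2 : \forall y \near x, `|x - y| < 2 ^- a.
  by apply: nbhsx_ballx; exact: expV2_gt0.
apply: filterS2 n1 n2 => y y1 ya; apply: lt_trans pe; apply: fa => //.
  by rewrite (le_trans _ xL)// lerDl.
by apply: le_trans xL; rewrite -lerBlDl (le_trans (lerB_dist _ _))// distrC ltW.
Qed.

(** For [c >= 0], a trapezoid equal to [c] where [|y| <= L - c] and to 0 where [|y| >= L]. Its sides
    have slope 1 whatever the height, so one modulus of continuity serves for all [c] and [L]. *)
Definition plateau (c L y : R) := Num.max 0 (Num.min c (L - `|y|)).

Lemma plateau_ge0 c L y : 0 <= plateau c L y.
Proof. by rewrite /plateau le_max lexx. Qed.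

Lemma plateau_le c L y : 0 <= c -> plateau c L y <= c.
Proof. by move=> c0; rewrite /plateau ge_max c0 ge_min lexx. Qed.

Lemma plateau_outside c L y : L <= `|y| -> plateau c L y = 0.
Proof. by move=> Ly; apply/max_idPl; rewrite ge_min subr_le0 Ly orbT. Qed.

Lemma plateau_inside c L y : 0 <= c -> `|y| <= L - c -> plateau c L y = c.
Proof.
move=> c0 yL; have -> : plateau c L y = Num.max 0 c; last exact/max_idPr.
by congr Num.max; apply/min_idPl; lra.
Qed.

Lemma plateau_lipschitz c L x y : `|plateau c L x - plateau c L y| <= `|x - y|.
Proof.
have := ler_dist_dist x y.
rewrite /plateau !maxEle !minEle.
do 4 case: ifPn; rewrite ?subrr ?normr0 -?ltNge ?normr_ge0// !ler_norml; lra.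
Qed.

Lemma continuous_plateau c L : continuous (plateau c L).
Proof.
move=> x; apply/cvgrPdist_lt => e e0.
have near_e : \forall y \near x, `|x - y| < e by exact: nbhsx_ballx.
by apply: filterS near_e => y; apply: le_lt_trans (plateau_lipschitz _ _ _ _).
Qed.

Definition clamp (b x : R) := Num.max (- b) (Num.min b x).

Lemma clamp_id b x : `|x| <= b -> clamp b x = x.
Proof.
by rewrite ler_norml => /andP[? ?]; rewrite /clamp (min_idPr _)//; apply/max_idPr.
Qed.

Lemma clamp0 x : clamp 0 x = 0.
Proof. by rewrite /clamp oppr0; apply/max_idPl; rewrite ge_min lexx. Qed.

Lemma norm_clamp b x : 0 <= b -> `|clamp b x| <= `|x|.
Proof.
rewrite /clamp maxEle minEle => b0.
by case: (ger0P x); do 2 case: ifPn; rewrite -?ltNge ler_norml; lra.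
Qed.

Lemma dist_clamp b x : 0 <= b -> `|x - clamp b x| <= `|x|.
Proof.
rewrite /clamp maxEle minEle => b0.
by case: (ger0P x); do 2 case: ifPn; rewrite -?ltNge ler_norml; lra.
Qed.

Lemma clamp_lipschitz b c x y e : `|b - c| < e -> `|x - y| < e ->
  `|clamp b x - clamp c y| < e.
Proof.
rewrite /clamp !maxEle !minEle !ltr_norml.
by do 4 case: ifPn; rewrite -?ltNge; lra.
Qed.

Lemma continuous_clamp f g : continuous f -> continuous g ->
  continuous (fun x => clamp (f x) (g x)).
Proof.
move=> cf cg x; apply/cvgrPdist_lt => e e0.
have /cvgrPdist_lt/(_ e e0) n1 := cf x; have /cvgrPdist_lt/(_ e e0) n2 := cg x.
by apply: filterS2 n1 n2 => y; exact: clamp_lipschitz.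
Qed.

End ContinuousFunctions.

(** * Integrals against a probability measure *)

Section ProbabilityIntegrals.
Context d (T : measurableType d) (R : realType) (P : probability T R).
Implicit Types (f g h : T -> R).

Lemma integrable_bounded f (M : R) : measurable_fun setT f ->
  (forall x, `|f x| <= M) -> P.-integrable setT (EFin \o f).
Proof.
move=> mf fM.
have PT : (P setT < +oo)%E by rewrite (probability_setT P) ltry.
apply: (measurable_bounded_integrable measurableT PT mf).
exists M; split; first exact: num_real.
  by move=> x Mx y _; rewrite /= (le_trans (fM y))// ltW.
Qed.

Lemma Rintegral_prob_cst (r : R) : \int[P]_x r = r.
Proof.
transitivity (r * fine (P setT)); first exact: Rintegral_cst.
by rewrite (probability_setT P) mulr1.
Qed.

Lemma norm_Rintegral_prob_le f (M : R) : measurable_fun setT f ->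
  (forall x, `|f x| <= M) -> `|\int[P]_x f x| <= M.
Proof.
move=> mf fM; have intf := integrable_bounded mf fM.
apply: (le_trans (le_normr_Rintegral measurableT intf)).
rewrite -[leRHS]Rintegral_prob_cst; apply: le_Rintegral => //.
- by have := integrable_abse intf; apply: eq_integrable.
- exact: finite_measure_integrable_cst.
Qed.

(** Meant for a trapezoid [h] of height 1: [e] bounds the difference on a compact set, and
    [M * (1 - h)] takes over in the tail, where [h] vanishes. *)
Lemma ler_dist_Rintegral_prob f g h (e M N : R) :
  measurable_fun setT f -> measurable_fun setT g -> measurable_fun setT h ->
  (forall y, `|f y| <= N) -> (forall y, `|g y| <= N) -> (forall y, `|h y| <= 1) ->
  (forall y, `|f y - g y| <= e + M * (1 - h y)) ->
  `|\int[P]_y f y - \int[P]_y g y| <= e + M * (1 - \int[P]_y h y).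
Proof.
move=> mf mg mh fN gN h1 fg.
have ih := integrable_bounded mh h1.
have ic r : P.-integrable setT (EFin \o cst r) by exact: finite_measure_integrable_cst.
have i1 : P.-integrable setT (EFin \o (fun y => 1 - h y)).
  by have := integrableB measurableT (ic 1) ih; apply: eq_integrable.
have i2 : P.-integrable setT (EFin \o (fun y => M * (1 - h y))).
  by have := integrableZl measurableT M i1; apply: eq_integrable.
have -> : e + M * (1 - \int[P]_y h y) = \int[P]_y (e + M * (1 - h y)).
  rewrite RintegralD//; last exact: (ic e).
  rewrite RintegralZl// RintegralB//; last exact: (ic 1).
  by rewrite !Rintegral_prob_cst.
apply: ler_dist_Rintegral => //.
- exact: (integrable_bounded mf fN).
- exact: (integrable_bounded mg gN).
- by have := integrableD measurableT (ic e) i2; apply: eq_integrable.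
Qed.

(** Dominated convergence, the constant 1 being both the limit and the dominating function. *)
Lemma Rintegral_cvg1 (h : nat -> T -> R) (e : R) : (forall n, measurable_fun setT (h n)) ->
  (forall n y, `|h n y| <= 1) -> (forall y, exists N, forall n, (N <= n)%N -> h n y = 1) ->
  0 < e -> exists n, 1 - e < \int[P]_y h n y.
Proof.
move=> mh h1 hy e0.
have ic : P.-integrable setT (EFin \o cst 1) by exact: finite_measure_integrable_cst.
have [|||||_ _ hcvg] := @dominated_convergence _ _ _ P setT measurableT
  (fun n => EFin \o h n) (EFin \o cst 1) (EFin \o cst 1).
- by move=> n; apply/measurable_EFinP.
- by apply/measurable_EFinP.
- apply: aeW => y _; have [N Ny] := hy y; apply: cvg_near_cst.
  by exists N => // n Nn; rewrite /= Ny.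
- exact: ic.
- by apply: aeW => y n _; rewrite /= lee_fin.
have P1 : (\int[P]_x (1 : R)%:E = 1%:E)%E.
  have /= := integrable_fin_num measurableT ic => /fineK <-.
  by rewrite [fine _]Rintegral_prob_cst.
move: hcvg; rewrite P1 => /fine_cvgP[_ /cvgrPdist_lt/(_ e e0)].
move=> [n _ /(_ n (leqnn _))] /=; rewrite ltr_norml => /andP[_].
by rewrite /Rintegral => ?; exists n; rewrite ltrBlDr -ltrBlDl.
Qed.
End ProbabilityIntegrals.

(** * Tails of dominated integrals *)

Section Tails.
Context d (T : measurableType d) (R : realType) (mu : {measure set T -> \bar R}).

Lemma Rintegral_setC (A : set T) (f : T -> R) : measurable A ->
  mu.-integrable setT (EFin \o f) ->
  \int[mu]_x f x = \int[mu]_(x in A) f x + \int[mu]_(x in ~` A) f x.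
Proof.
move=> mA intf; rewrite -[in LHS](setUv A) Rintegral_setU//.
- exact: measurableC.
- by rewrite setUv.
- exact/disj_setPCl.
Qed.

(** Both differences are integrals over the complement of [A], where [g] dominates [f]; the bound
    does not depend on [f]. *)
Lemma dist_Rintegral_tail (A : set T) (f g : T -> R) : measurable A ->
  measurable_fun setT f -> mu.-integrable setT (EFin \o g) ->
  (forall x, `|f x| <= g x) ->
  `|\int[mu]_x f x - \int[mu]_(x in A) f x| <=
  \int[mu]_x g x - \int[mu]_(x in A) g x.
Proof.
move=> mA mf intg fg.
have intf : mu.-integrable setT (EFin \o f).
  apply: le_integrable intg => //; first exact/measurable_EFinP.
  by move=> x _; rewrite /= lee_fin (le_trans (fg x))// ler_norm.
rewrite (Rintegral_setC mA intf) (Rintegral_setC mA intg) !(addrC (Rintegral _ A _)) !addrK.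
have mAC := measurableC mA.
have intS h : mu.-integrable setT (EFin \o h) -> mu.-integrable (~` A) (EFin \o h).
  by apply: integrableS.
apply: (le_trans (le_normr_Rintegral mAC (intS _ intf))).
apply: le_Rintegral => //; last exact: intS.
by have := integrable_abse (intS _ intf); apply: eq_integrable.
Qed.
End Tails.

(** * Lebesgue integrals over intervals: exhaustion of the line and Riemann sums *)

Section LebesgueIntegrals.
Variable R : realType.
Notation mu := (@lebesgue_measure R).
Implicit Types f g : R -> R.

Lemma integrable_itv f a b : continuous f -> mu.-integrable `[a, b] (EFin \o f).
Proof.
move=> cf; apply: continuous_compact_integrable; first exact: segment_compact.
exact: continuous_subspaceT.
Qed.

Lemma Rintegral_itv_cst a b (r : R) : a <= b ->
  \int[mu]_(y in `[a, b]) r = r * (b - a).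
Proof.
move=> ab; transitivity (r * fine (lebesgue_measure (`[a, b]%classic : set R))).
  by apply: Rintegral_cst; exact: measurable_itv.
rewrite lebesgue_measure_itv/= lte_fin; case: ltP => //= ba.
by have -> : b = a by [lra]; rewrite subrr.
Qed.

Lemma integrable_itv_cst a b (r : R) : mu.-integrable `[a, b] (EFin \o cst r).
Proof. by apply: integrable_itv => x; exact: cvg_cst. Qed.

(** Monotone convergence along the intervals [[- i, i]]. The integral is extended real because
    integrability of [g] will be deduced from this bound. *)
Lemma integral_le_of_itv g S J : continuous g -> (forall x, 0 <= g x) ->
  (forall j : nat, (J <= j)%N -> \int[mu]_(x in `[- j%:R, j%:R]) g x <= S) ->
  (\int[mu]_x (g x)%:E <= S%:E)%E.
Proof.
move=> cg g0 gS.
pose F (i : nat) : set R := `[- i%:R, i%:R]%classic.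
have FT : \bigcup_i F i = setT.
  apply/seteqP; split => // x _; exists (Num.truncn `|x|).+1 => //.
  by rewrite /F/= in_itv/= -ler_norml ltW// truncnS_gt.
have := @ge0_nondecreasing_set_cvg_integral _ (measurableTypeR R) R F (EFin \o g) mu.
rewrite FT => cvgF.
have {}cvgF : (\int[mu]_(x in F i) (EFin \o g) x @[i --> \oo] -->
    \int[mu]_x (EFin \o g) x)%E.
  apply: cvgF => //.
  - move=> i j ij; rewrite subsetEset => x; rewrite /F/= !in_itv/= -!ler_norml => xi.
    by rewrite (le_trans xi)// ler_nat.
  - by move=> i; exact: measurable_itv.
  - by move=> i; exact: measurable_int (integrable_itv _ _ cg).
  - by move=> i x _; rewrite lee_fin.
have <- := cvg_lim _ cvgF => //.
apply: lime_le; first by apply/cvg_ex; eexists; exact: cvgF.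
exists J => // j Jj /=.
have /fineK <- : (\int[mu]_(x in F j) (g x)%:E)%E \is a fin_num.
  apply: (integrable_fin_num _ (integrable_itv (- j%:R) j%:R cg)).
  exact: measurable_itv.
by rewrite lee_fin; exact: gS.
Qed.

(** Induction on the number of cells: with values taken at left endpoints, each cell of length [s]
    contributes an error of at most [s * e]. *)
Lemma riemann_sum f a s e c : continuous f -> 0 <= s -> 0 <= e ->
  (forall i, (i < c)%N -> forall y, a + i%:R * s <= y <= a + i.+1%:R * s ->
     `|f (a + i%:R * s) - f y| <= e) ->
  `|s * (\sum_(i < c) f (a + i%:R * s)) - \int[mu]_(y in `[a, a + c%:R * s]) f y|
    <= c%:R * s * e.
Proof.
move=> cf s0 e0; elim: c => [|c IH] fe.
  by rewrite big_ord0 mulr0 !mul0r addr0 set_itv1 Rintegral_set1 subrr normr0.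
rewrite big_ord_recr/= mulrDr.
have fe' i : (i < c)%N -> forall y, a + i%:R * s <= y <= a + i.+1%:R * s ->
    `|f (a + i%:R * s) - f y| <= e by move=> ic; apply: fe; exact: ltnW.
have := IH fe'; have := fe c (ltnSn _).
set b := a + c%:R * s; have bE : a + c.+1%:R * s = b + s.
  by rewrite /b -addn1 natrD mulrDl mul1r addrA.
rewrite bE => feb IHc.
have ab : a <= b by rewrite lerDl mulr_ge0.
have bbs : b <= b + s by rewrite lerDl.
have -> : \int[mu]_(y in `[a, b + s]) f y =
    \int[mu]_(y in `[a, b]) f y + \int[mu]_(y in `[b, b + s]) f y.
  (* The common endpoint [b] is negligible, so the last cell may be taken open on the left, which
     makes the two intervals disjoint. *)
  rewrite -[\int[mu]_(y in `[b, b + s]) f y]Rintegral_itv_obnd_cbnd; last first.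
    apply: integrableS (integrable_itv b (b + s) cf); [exact: measurable_itv|exact: measurable_itv|].
    by move=> y; rewrite /= !in_itv/= => /andP[/ltW -> ->].
  rewrite -(Rintegral_itvB (x := b) (integrable_itv a (b + s) cf)) ?bnd_simp//.
  ring.
have cstI r : \int[mu]_(y in `[b, b + s]) r = r * s.
  by rewrite Rintegral_itv_cst// addrC addKr.
have step : `|s * f b - \int[mu]_(y in `[b, b + s]) f y| <= s * e.
  (* Both [s * f b] and [s * e] are turned into integrals of constants over the cell. *)
  rewrite mulrC (mulrC s) -!cstI; apply: ler_dist_Rintegral.
  - exact: measurable_itv.
  - exact: integrable_itv_cst.
  - exact: integrable_itv.
  - exact: integrable_itv_cst.
  - by move=> y /=; rewrite in_itv/=; exact: feb.
rewrite opprD addrACA (le_trans (ler_normD _ _))// -natr1 !mulrDl mul1r lerD//.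
Qed.


End LebesgueIntegrals.

(** * Computable functions in terms of coded indices *)

Section ComputableFunctions.
Variable R : realType.

(** The tuple of indices is replaced by its code [c], so that afterwards only [cR] sequences and a
    modulus on plain numbers have to be handled. *)
Lemma computable_fun_of_cR k (G : nat -> R -> R) (c : k.-tuple nat -> nat)
    (A : nat -> nat -> nat -> nat) :
  recursive c -> crec3 A ->
  (forall x, cR x -> cR2 (fun n j => G n (x j))) ->
  (forall n L p x y, `|x| <= L%:R -> `|y| <= L%:R -> `|x - y| < 2 ^- A n L p ->
     `|G n x - G n y| < 2 ^- p) ->
  computable_fun (fun t => G (c t)).
Proof.
move=> rc rA Gx GA; split=> [x /cR_seq1 cx|].
  have := computable_of_cR (Gx x cx) (rec_pr (rec_comps rc (@recs_behead k)) (rec_thead k)).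
  by congr computable_real; apply/funext => t; rewrite p1_pr p2_pr.
exists (fun t : k.+2.-tuple nat => A (c [tuple of behead [tuple of behead t]]) (thead t)
                   (thead [tuple of behead t])); split.
  apply: crec3_rec => //; last 2 first.
  - exact: rec_thead.
  - exact: (rec_comps (rec_thead _) (@recs_behead _)).
  - exact: (rec_comps rc (recs_comp (@recs_behead _) (@recs_behead _))).
move=> n L p x y xL yL; rewrite !theadE.
have -> : [tuple of behead [tuple of behead [tuple of L :: p :: n]]] = n by apply/val_inj.
exact: GA.
Qed.

Lemma computable_fun_seq2 (F : nat -> nat -> R -> R) (A : nat -> nat -> nat -> nat -> nat) :
  crec3 (fun z => A (p1 z) (p2 z)) ->
  (forall x, cR x -> cR2 (fun z j => F (p1 z) (p2 z) (x j))) ->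
  (forall n m L p x y, `|x| <= L%:R -> `|y| <= L%:R -> `|x - y| < 2 ^- A n m L p ->
     `|F n m x - F n m y| < 2 ^- p) ->
  computable_fun (seq2 F).
Proof.
move=> rA Fx FA.
have rc : recursive (fun t : 2.-tuple nat => pr (tnth t ord0) (tnth t ord_max)).
  by apply: rec_pr; exact: rec_proj.
have := computable_fun_of_cR (G := fun z => F (p1 z) (p2 z)) rc rA Fx
  (fun z => FA (p1 z) (p2 z)).
by congr computable_fun; apply/funext => t; rewrite p1_pr p2_pr.
Qed.

Lemma computable_real_seq2 (x : nat -> nat -> R) : computable_real (seq2 x) -> cR2 x.
Proof.
move=> cx.
have tr : trec (fun z => [tuple of p1 z :: [tuple of p2 z :: [tuple]]]).
  by apply: trec_cons; [crec|apply: trec_cons; [crec|exact: trec_nil]].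
exact: cR_of_computable cx tr.
Qed.

Variable f : nat -> R * R -> R.
Hypothesis cf : computable_fun2 (seq1 f).

(** The definition provides a double sequence, indexed by points and functions; this is its
    restriction to the index pairs [(n, a n)]. *)
Lemma cR_fun2 x y a : cR x -> cR y -> crec a -> cR (fun n => f (a n) (x n, y n)).
Proof.
move=> /cR_seq1 cx /cR_seq1 cy ra; have [/(_ x y cx cy) cxy _] := cf.
have tr : trec (fun z => [tuple of z :: [tuple of a z :: [tuple]]]).
  by apply: trec_cons; [crec|apply: trec_cons; [crec|exact: trec_nil]].
exact: cR_of_computable cxy tr.
Qed.

Lemma fun2_modulus : exists A : nat -> nat -> nat -> nat, crec3 A /\
  forall n H p x y z w, `|x| <= H%:R -> `|y| <= H%:R -> `|z| <= H%:R -> `|w| <= H%:R ->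
    `|x - y| < 2 ^- A n H p -> `|z - w| < 2 ^- A n H p ->
    `|f n (x, z) - f n (y, w)| < 2 ^- p.
Proof.
have [_ [alpha [ralpha fa]]] := cf.
exists (fun n H p => alpha [tuple of H :: p :: [tuple of n :: [tuple]]]); split.
  apply: (trec_comp (a := fun z => [tuple of p1 (p2 z) :: [tuple of p2 (p2 z) ::
    [tuple of p1 z :: [tuple]]]])) => //.
  by do 3![apply: trec_cons; first by crec]; exact: trec_nil.
by move=> n H p x y z w; have := fa [tuple of n :: [tuple]] H p x y z w.
Qed.

Lemma fun2_continuous n x : continuous (fun y => f n (x, y)).
Proof.
have [A [_ fA]] := fun2_modulus.
apply: continuous_of_modulus => L p.
pose X := (Num.truncn `|x|).+1; exists (A n (X + L)%N p) => y z yL zL yz.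
have xX : `|x| <= (X + L)%:R by rewrite natrD ler_wpDr// ltW// truncnS_gt.
have LX : L%:R <= (X + L)%:R :> R by rewrite ler_nat leq_addl.
apply: (fA n (X + L)%N p x x y z) => //; [exact: (le_trans yL)|exact: (le_trans zL)|].
by rewrite subrr normr0 expV2_gt0.
Qed.

Lemma fun2_measurable n x : measurable_fun setT (fun y => f n (x, y)).
Proof. by apply: continuous_measurable_fun; exact: fun2_continuous. Qed.

End ComputableFunctions.

(** * Statement (1): integrals against a computable sequence of distributions *)

Section DistributionIntegrals.
Variables (R : realType) (f : nat -> R * R -> R).
Variable mu : nat -> probability (measurableTypeR R) R.
Hypotheses (cf : computable_fun2 (seq1 f)) (cmu : computable_distr mu).

Lemma cR_distr (h : nat -> R -> R) A K : crec3 A -> crec K ->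
  (forall y, cR y -> cR2 (fun n i => h n (y i))) ->
  (forall n L p x y, `|x| <= L%:R -> `|y| <= L%:R -> `|x - y| < 2 ^- A n L p ->
     `|h n x - h n y| < 2 ^- p) ->
  (forall n x, (K n)%:R <= `|x| -> h n x = 0) ->
  cR2 (fun m n => \int[mu m]_x h n x).
Proof.
move=> rA rK hy hA hK; apply: computable_real_seq2; apply: cmu; split.
  exact: (computable_fun_of_cR (rec_proj ord0) rA hy hA).
exists (seq1 K); split => // n x; exact: hK.
Qed.

Lemma cR_plateau (c L : nat -> nat) (y : nat -> R) : crec c -> crec L -> cR y ->
  cR (fun n => plateau (c n)%:R (L n)%:R (y n)).
Proof.
move=> rc rL cy; apply: cR_max; first exact: (cR_nat R (crec_const 0)).
by apply: cR_min; [exact: cR_nat|apply: cR_addn => //; apply/cR_N/cR_norm].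
Qed.

Lemma cR_clamp (b y : nat -> R) : cR b -> cR y -> cR (fun n => clamp (b n) (y n)).
Proof. by move=> cb cy; apply: cR_max; [exact: cR_N|exact: cR_min]. Qed.

Lemma measurable_plateau (c L : R) : measurable_fun setT (plateau c L).
Proof. by apply: continuous_measurable_fun; exact: continuous_plateau. Qed.

Lemma tightness : exists K : nat -> nat -> nat, crec2 K /\
  forall m N, 1 - 2 ^- N <= \int[mu m]_y plateau 1 (K m N)%:R y.
Proof.
apply: (cR_search (phi := fun m L => \int[mu m]_y plateau 1 L%:R y)).
  (* Slope 1 makes [p] itself a modulus of continuity, and the trapezoid of index [L] vanishes from
     [L] on, whence [id]. *)
  apply: (@cR_distr (fun L => plateau 1 L%:R) (fun _ _ p => p) id).
  - by crec.
  - exact: crec_id.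
  - by move=> y cy; apply: (cR_plateau (c := fun=> 1%N)); [crec|crec|apply: cR_comp => //; crec].
  - by move=> n L p x y _ _; apply: le_lt_trans (plateau_lipschitz _ _ _ _).
  - by move=> n x; exact: plateau_outside.
move=> m e e0; apply: Rintegral_cvg1 => //.
- by move=> n; exact: measurable_plateau.
- by move=> n y; rewrite ger0_norm ?plateau_ge0// plateau_le.
(* One unit makes the truncation exceed [|y|], the other is the width of the sloping side. *)
- move=> y; exists (Num.truncn `|y|).+2 => n yn; apply: plateau_inside => //.
  rewrite lerBrDr (le_trans _ (_ : (Num.truncn `|y|).+2%:R <= n%:R))// ?ler_nat//.
  by rewrite -addn1 natrD lerD2r ltW// truncnS_gt.
Qed.

(** A factor [M] is absorbed by [M] additional bits, as [M <= 2 ^ M]. *)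
Lemma nat_mul_expV2 M N : M%:R * 2 ^- (N + M) <= 2 ^- N :> R.
Proof.
rewrite exprD invfM mulrCA ler_piMr ?expV2_ge0// ler_pdivrMr ?exprn_gt0// mul1r.
by rewrite -natrX ler_nat ltnW// ltn_expl.
Qed.

Hypothesis bf : effectively_bounded (seq1 f).

Lemma effective_bound : exists M, crec M /\ forall n z, `|f n z| <= (M n)%:R.
Proof.
have [M [rM fM]] := bf; exists (fun n => M [tuple of n :: [tuple]]); split.
  apply: (trec_comp (a := fun n => [tuple of n :: [tuple]])) => //.
  by apply: trec_cons; [exact: crec_id|exact: trec_nil].
by move=> n z; exact: fM [tuple of n :: [tuple]] z.
Qed.

(** Every [mu m] has total mass 1, so the bound for [f n] serves for all [m]. *)
Lemma effectively_bounded_distr :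
  effectively_bounded (seq2 (fun n m x => \int[mu m]_y f n (x, y))).
Proof.
have [M [rM fM]] := bf; exists (fun t => M [tuple of tnth t ord0 :: [tuple]]); split.
  apply: (rec_comps rM (h := fun t : 2.-tuple nat => [tuple of tnth t ord0 :: [tuple]])).
  by apply: recs_cons; [exact: rec_proj|exact: recs_nil].
move=> t x; apply: norm_Rintegral_prob_le; first exact: fun2_measurable.
move=> y; exact: fM [tuple of tnth t ord0 :: [tuple]] (x, y).
Qed.

Lemma computable_fun_distr :
  computable_fun (seq2 (fun n m x => \int[mu m]_y f n (x, y))).
Proof.
have [M [rM fM]] := effective_bound.
have [K [rK KP]] := tightness.
have [A [rA fA]] := fun2_modulus cf.
(* On the compact set [f n] varies by at most [2 ^- p.+2]; the tail mass [2 ^- (p.+3 + M n)],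
   weighted by [2 * M n], costs no more than another [2 ^- p.+2]. The sum is below [2 ^- p]. *)
apply: (@computable_fun_seq2 _ _
  (fun n m L p => A n (L + K m (p.+3 + M n))%N p.+2)) => [|x cx|n m L p x y xL yL xy].
- by crec.
(* Clamping [f] between [- plateau] and [plateau] makes its support compact
   without any multiplication of computable reals. *)
- pose h q y := clamp (plateau (M (p1 (p1 q)))%:R (p2 q)%:R y)
                  (f (p1 (p1 q)) (x (p2 (p1 q)), y)).
  have [B [rB xB]] := cR_bound cx.
  have ch : cR2 (fun m q => \int[mu m]_y h q y).
    (* Here [q] codes the index of [f], that of [x] and the support bound. The trapezoid has modulus
       [p]; for [f], the radius [B + L] covers both coordinates. *)
    apply: (@cR_distr _ (fun q L p => maxn p (A (p1 (p1 q)) (B (p2 (p1 q)) + L)%N p)) p2).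
    + by crec.
    + by crec.
    + move=> y cy; apply: cR_clamp.
        apply: cR_plateau; [crec|crec|apply: cR_comp => //; crec].
      apply: cR_fun2 => //; [apply: cR_comp => //; crec|apply: cR_comp => //; crec|crec].
    + move=> q L p y z yL zL yz; apply: clamp_lipschitz.
        apply: (le_lt_trans (plateau_lipschitz _ _ _ _)).
        by apply: (lt_le_trans yz); apply: ler_expV2; exact: leq_maxl.
      apply: (fA _ (B (p2 (p1 q)) + L)%N).
      * by rewrite natrD ler_wpDr.
      * by rewrite natrD ler_wpDr.
      * by rewrite natrD ler_wpDl.
      * by rewrite natrD ler_wpDl.
      * by rewrite subrr normr0 expV2_gt0.
      * by apply: (lt_le_trans yz); apply: ler_expV2; exact: leq_maxr.
    + by move=> q y yq; rewrite /h plateau_outside// clamp0.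
  (* Here [w] codes [n], [m] and the index of [x]. The mass beyond [k] is at most [2 ^- (N + M n)];
     the support bound [k + M n] lets a trapezoid of height [M n] be full up to [k]. *)
  pose k w N := K (p2 (p1 w)) (N + M (p1 (p1 w)))%N.
  pose q w N := pr (pr (p1 (p1 w)) (p2 w)) (k w N + M (p1 (p1 w)))%N.
  apply: (cR_lim (y := fun w N => \int[mu (p2 (p1 w))]_y h (q w N) y)).
    by apply: (cR2_comp ch); rewrite /q /k; crec.
  move=> w N; set m := p2 (p1 w); set n := p1 (p1 w).
  have hE y : h (q w N) y =
      clamp (plateau (M n)%:R (k w N + M n)%:R y) (f n (x (p2 w), y)).
    by rewrite /h /q !(p1_pr, p2_pr).
  have mh : measurable_fun setT (h (q w N)).
    apply: continuous_measurable_fun; apply: continuous_clamp.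
      exact: continuous_plateau.
    exact: fun2_continuous.
  (* The compact error term is 0, because clamping changes nothing for [|y| <= k]; beyond, the
     change is at most [M n]. *)
  apply: (@le_trans _ _ (0 + (M n)%:R * (1 - \int[mu m]_y plateau 1 (k w N)%:R y))).
    apply: (@ler_dist_Rintegral_prob _ _ _ _ _ _ _ _ _ (M n)%:R) => //.
    + exact: fun2_measurable.
    + exact: measurable_plateau.
    + by move=> y; rewrite hE (le_trans (norm_clamp _ (plateau_ge0 _ _ _))).
    + by move=> y; rewrite ger0_norm ?plateau_ge0// plateau_le.
    move=> y; rewrite add0r hE; have [yk|ky] := lerP `|y| (k w N)%:R.
      rewrite clamp_id ?subrr ?normr0 ?mulr_ge0 ?subr_ge0 ?plateau_le//.
      by rewrite plateau_inside// natrD addrK.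
    rewrite (plateau_outside _ (ltW ky)) subr0 mulr1 distrC.
    by rewrite (le_trans (dist_clamp _ (plateau_ge0 _ _ _))).
  rewrite add0r (le_trans _ (nat_mul_expV2 (M n) N))// ler_wpM2l//.
  by have := KP m (N + M n)%N; rewrite -/m -/n /k; lra.
- set k := K m (p.+3 + M n)%N.
  have := KP m (p.+3 + M n)%N; rewrite -/k => kP.
  have nM := nat_mul_expV2 (M n) p.+3.
  (* The factor 2 arises in the tail, where the two values of [f n] are bounded separately by
     [M n]. *)
  apply: (@le_lt_trans _ _ (2 ^- p.+2 +
      (2 * (M n)%:R) * (1 - \int[mu m]_y plateau 1 k%:R y))).
    apply: (@ler_dist_Rintegral_prob _ _ _ _ _ _ _ _ _ (M n)%:R) => //.
    + exact: fun2_measurable.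
    + exact: fun2_measurable.
    + exact: measurable_plateau.
    + by move=> z; rewrite ger0_norm ?plateau_ge0// plateau_le.
    move=> z; have [zk|kz] := lerP `|z| k%:R.
      apply: ler_wpDr; first by rewrite !mulr_ge0// subr_ge0 plateau_le.
      have zLk : `|z| <= (L + k)%:R by rewrite natrD ler_wpDl.
      have xLk : `|x| <= (L + k)%:R by rewrite natrD ler_wpDr.
      have yLk : `|y| <= (L + k)%:R by rewrite natrD ler_wpDr.
      apply/ltW/(fA n (L + k)%N) => //.
      by rewrite subrr normr0 expV2_gt0.
    rewrite (plateau_outside _ (ltW kz)) subr0 mulr1.
    rewrite (le_trans (ler_normB _ _))// ler_wpDl ?expV2_ge0// mulrDl mul1r lerD//.
  have : (M n)%:R * (1 - \int[mu m]_y plateau 1 k%:R y) <=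
      (M n)%:R * 2 ^- (p.+3 + M n) by rewrite ler_wpM2l//; lra.
  have := expV2_gt0 R p.+3.
  move: nM; rewrite (half_expV R p) (half_expV R p.+1) (half_expV R p.+2); lra.
Qed.
End DistributionIntegrals.

(** * Statement (2): dominated Lebesgue integrals *)

Section DominatedIntegrals.
Variables (R : realType) (f : nat -> R * R -> R) (g : R -> R).
Notation mu := (@lebesgue_measure R).
Hypotheses (cf : computable_fun2 (seq1 f)) (cg : computable_fun (seq0 g)).
Hypothesis ig : effectively_integrable g.
Hypothesis fg : forall n x y, `|f n (x, y)| <= g y.

Let g_ge0 y : 0 <= g y.
Proof. exact: le_trans (normr_ge0 _) (fg 0%N 0 y). Qed.

Let g_cont : continuous g.
Proof.
have [_ [alpha [_ ga]]] := cg.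
apply: continuous_of_modulus => L p.
by exists (alpha [tuple of L :: p :: [tuple]]); exact: (ga [tuple]).
Qed.

(** The integral of [g] over the line is at most [Ip + 2 ^- k.+1] by monotone convergence, and the
    one up to [E k] is at least [Ip - 2 ^- k.+1]. *)
Lemma effective_tail : exists E, crec E /\ mu.-integrable setT (EFin \o g) /\
  forall k, \int[mu]_y g y - \int[mu]_(y in `[- (E k)%:R, (E k)%:R]) g y <= 2 ^- k.
Proof.
have [e [re [Ip [In eP]]]] := ig.
pose E k := e [tuple of k.+1 :: [tuple]].
have rE : crec E.
  apply: (trec_comp (a := fun k => [tuple of k.+1 :: [tuple]])) => //.
  by apply: trec_cons; [exact: (crec_S crec_id)|exact: trec_nil].
have gE j : \int[mu]_(y in `[- j%:R, j%:R]) g^\+ y = \int[mu]_(y in `[- j%:R, j%:R]) g y.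
  by apply: eq_Rintegral => y _; exact/max_idPl.
have EP k j : (E k <= j)%N ->
    `|\int[mu]_(y in `[- j%:R, j%:R]) g y - Ip| <= 2 ^- k.+1.
  by move=> kj; have [+ _] := eP k.+1 j kj; rewrite gE.
have gS k : (\int[mu]_y (g y)%:E <= (Ip + 2 ^- k.+1)%:E)%E.
  apply: (@integral_le_of_itv _ _ _ (E k)) => // j /EP.
  by rewrite ler_norml => /andP[_]; rewrite lerBlDl.
have intg : mu.-integrable setT (EFin \o g).
  apply/integrableP; split.
    apply/measurable_EFinP; exact: continuous_measurable_fun.
  have -> : (\int[mu]_x `|(EFin \o g) x| = \int[mu]_x (g x)%:E)%E.
    by apply: eq_integral => y _; rewrite /= ger0_norm.
  by apply: le_lt_trans (gS 0%N) _; rewrite ltry.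
exists E; split => //; split => // k.
have := EP k (E k) (leqnn _); rewrite ler_norml => /andP[+ _].
have : \int[mu]_y g y <= Ip + 2 ^- k.+1.
  rewrite -lee_fin; apply: le_trans (gS k); rewrite fineK//.
  exact: integrable_fin_num.
rewrite (half_expV R k); lra.
Qed.

Lemma computable_fun_lebesgue : computable_fun (seq1 (fun n x => \int[mu]_y f n (x, y))).
Proof.
have [E [rE [intg EP]]] := effective_tail.
have [A [rA fA]] := fun2_modulus cf.
have tail n x k :
    `|\int[mu]_y f n (x, y) - \int[mu]_(y in `[- (E k)%:R, (E k)%:R]) f n (x, y)| <= 2 ^- k.
  apply: le_trans (EP k); apply: dist_Rintegral_tail => //.
  exact: fun2_measurable.
have NE k : - (E k)%:R <= (E k)%:R :> R by rewrite ge0_cp.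
(* Each of the two tails beyond [J] costs [2 ^- p.+2], and so does the interval of length [2 * J],
   where [2 * J] extra bits absorb the length: three quarters of [2 ^- p] in all. *)
apply: (computable_fun_of_cR (rec_proj ord0)
  (A := fun n L p => let J := E p.+2 in A n (L + J)%N (p.+2 + 2 * J)%N)) =>
  [|x cx|n L p x y xL yL /= xy].
- by rewrite /=; crec.
- have [B [rB xB]] := cR_bound cx.
  (* The tail beyond [J] takes half of the error [2 ^- N]. The Riemann sum takes the other half, so
     [f] may vary by [2 ^- P] on a cell, the total length being [2 * J]. *)
  pose J (w N : nat) := E N.+1; pose P w N := (N.+1 + 2 * J w N)%N.
  (* The successor makes the mesh [2 ^- s] strictly smaller than the modulus; [c] cells of this mesh
     fill [[- J, J]]. *)
  pose s w N : nat := (A (p1 w) (B (p2 w) + J w N)%N (P w N)).+1.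
  pose c w N : nat := (2 * J w N * 2 ^ s w N)%N.
  have rJ : crec2 J by rewrite /J; crec.
  have rs : crec2 s by rewrite /s /P; crec.
  have rc : crec2 c by rewrite /c; crec.
  (* The grid point [- J + i * 2 ^- s], written as a dyadic fraction to suit [cR_rat0]. *)
  pose pt w N i : R := (i%:R - (J w N * 2 ^ s w N)%N%:R) / 2 ^+ s w N.
  apply: (cR_lim (y := fun w N =>
    (\sum_(i < c w N) f (p1 w) (x (p2 w), pt w N i)) / 2 ^+ s w N)).
    apply: (cR_sum (y := fun z i => f (p1 (p1 z)) (x (p2 (p1 z)), pt (p1 z) (p2 z) i))) => //.
    apply: cR_fun2 => //; last by crec.
      by apply: cR_comp => //; crec.
    by apply: cR_rat0; crec.
  move=> w N; set n := p1 w; set j := p2 w.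
  have s0 : 0 <= 2 ^- s w N :> R by exact: expV2_ge0.
  have cs : (c w N)%:R * 2 ^- s w N = 2 * (J w N)%:R :> R.
    by rewrite /c !natrM natrX mulfK// expf_neq0.
  have ptE i : pt w N i = - (J w N)%:R + i%:R * 2 ^- s w N.
    by rewrite /pt natrM natrX mulrBl mulfK ?expf_neq0// addrC.
  have JE : - (J w N)%:R + (c w N)%:R * 2 ^- s w N = (J w N)%:R :> R.
    by rewrite cs; ring.
  have := @riemann_sum _ (fun y => f n (x j, y)) (- (J w N)%:R) (2 ^- s w N)
    (2 ^- P w N) (c w N) (@fun2_continuous _ _ cf n (x j)) s0 (expV2_ge0 _ _).
  rewrite JE cs => riem.
  have {}riem : `|(\sum_(i < c w N) f n (x j, pt w N i)) / 2 ^+ s w N -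
      \int[mu]_(y in `[- (J w N)%:R, (J w N)%:R]) f n (x j, y)| <= 2 ^- N.+1.
    rewrite mulrC; under eq_bigr do rewrite ptE.
    apply: (le_trans (riem _)); last first.
      by rewrite -natrM; exact: nat_mul_expV2.
    move=> i ic y /andP[y1 y2].
    have yi : i.+1%:R * 2 ^- s w N <= (c w N)%:R * 2 ^- s w N :> R.
      by rewrite ler_wpM2r// ler_nat.
    have i0 : 0 <= i%:R * 2 ^- s w N :> R by rewrite mulr_ge0.
    have i1 : i.+1%:R * 2 ^- s w N = i%:R * 2 ^- s w N + 2 ^- s w N :> R.
      by rewrite -natr1 mulrDl mul1r.
    have yJ : `|y| <= (J w N)%:R by rewrite ler_norml; lra.
    have iJ : `|- (J w N)%:R + i%:R * 2 ^- s w N| <= (J w N)%:R :> R by rewrite ler_norml; lra.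
    apply/ltW/(fA n (B j + J w N)%N) => //.
    + by rewrite natrD ler_wpDr.
    + by rewrite natrD ler_wpDr.
    + by rewrite natrD ler_wpDl.
    + by rewrite natrD ler_wpDl.
    + by rewrite subrr normr0 expV2_gt0.
    + have : 2 ^- s w N < 2 ^- A n (B j + J w N)%N (P w N) :> R.
        by rewrite (half_expV R (A _ _ _)) ltrDl expV2_gt0.
      by rewrite ltr_norml; lra.
  have := tail n (x j) N.+1; move: riem; rewrite !ler_norml (half_expV R N); lra.
- set J := E p.+2 in xy.
  have := tail n x p.+2; have := tail n y p.+2; rewrite -/J.
  set I := `[- J%:R, J%:R]%classic.
  have : `|\int[mu]_(z in I) f n (x, z) - \int[mu]_(z in I) f n (y, z)| <= 2 ^- p.+2.
    apply: (@le_trans _ _ (\int[mu]_(z in I) 2 ^- (p.+2 + 2 * J))).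
      apply: ler_dist_Rintegral.
      + exact: measurable_itv.
      + by apply: integrable_itv; exact: fun2_continuous.
      + by apply: integrable_itv; exact: fun2_continuous.
      + exact: integrable_itv_cst.
      move=> z; rewrite /I/= in_itv/= -ler_norml => zJ.
      have xLJ : `|x| <= (L + J)%:R by rewrite natrD ler_wpDr.
      have yLJ : `|y| <= (L + J)%:R by rewrite natrD ler_wpDr.
      have zLJ : `|z| <= (L + J)%:R by rewrite natrD ler_wpDl.
      apply/ltW/(fA n (L + J)%N) => //.
      by rewrite subrr normr0 expV2_gt0.
    rewrite Rintegral_itv_cst; last exact: NE.
    have -> : J%:R - - J%:R = (2 * J)%N%:R :> R by rewrite natrM; ring.
    by rewrite mulrC nat_mul_expV2.
  have := expV2_gt0 R p.+2.
  rewrite !ler_norml ltr_norml (half_expV R p) (half_expV R p.+1); lra.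
Qed.
End DominatedIntegrals.


Unset Implicit Arguments.

Theorem theorem3p5 (R : realType) (f : nat -> R * R -> R)
    (mu : nat -> probability (measurableTypeR R) R) :
  computable_fun2 (seq1 f) -> computable_distr mu ->
  (effectively_bounded (seq1 f) ->
     effectively_bounded (seq2 (fun n m x => \int[mu m]_y f n (x, y))) /\
     computable_fun (seq2 (fun n m x => \int[mu m]_y f n (x, y)))) /\
  ((exists g : R -> R,
      [/\ computable_fun (seq0 g), effectively_integrable g &
          forall n x y, `|f n (x, y)| <= g y]) ->
     computable_fun
       (seq1 (fun n x => \int[lebesgue_measure]_y f n (x, y)))).
Proof.
move=> cf cmu; split=> [bf|[g [cg ig fg]]].
  split; first exact: effectively_bounded_distr.
  exact: computable_fun_distr.
exact: (computable_fun_lebesgue cf cg ig fg).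
Qed.
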